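(* Among the fifteen two-element pattern sets $\Pi\subseteq\mathfrak{S}_3$, the $\mathrm{bdes}$-Wilf equivalence classes are exactly the following seven: (1) $\{\{213,231\},\{132,312\},\{213,312\},\{132,231\}\}$; (2) $\{\{231,321\},\{312,321\}\}$; (3) $\{\{123,231\},\{123,312\}\}$; (4) $\{\{132,321\},\{213,321\}\}$; (5) $\{\{123,132\},\{123,213\},\{132,213\}\}$; (6) $\{\{123,321\}\}$; (7) $\{\{231,312\}\}$. In particular, classes (1) and (5) contain non-trivial $\mathrm{bdes}$-Wilf equivalences.
   Context: $\mathfrak{S}_n$ is the set of permutations $\pi=\pi_1\pi_2\cdots\pi_n$ of $[n]=\{1,\dots,n\}$ in one-line notation ($\mathfrak{S}_0$ consists of the empty permutation). A permutation $\pi$ avoids $\sigma\in\mathfrak{S}_k$ if no subsequence of $\pi$ of length $k$ has the same relative order as $\sigma$. For a set $\Pi$ of patterns, $\mathfrak{S}_n(\Pi)$ is the set of permutations in $\mathfrak{S}_n$ avoiding every pattern in $\Pi$. An index $k\in[n-1]$ is a big descent of $\pi\in\mathfrak{S}_n$ if $\pi_k>\pi_{k+1}+1$; $\mathrm{bdes}(\pi)$ is the number of big descents of $\pi$. Two pattern sets $\Pi,\Pi'$ are $\mathrm{bdes}$-Wilf equivalent if $\sum_{\pi\in\mathfrak{S}_n(\Pi)}t^{\mathrm{bdes}(\pi)}=\sum_{\pi\in\mathfrak{S}_n(\Pi')}t^{\mathrm{bdes}(\pi)}$ for all $n\ge 0$. The reverse-complement of $\pi\in\mathfrak{S}_n$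 is $\pi^{rc}=(n+1-\pi_n)(n+1-\pi_{n-1})\cdots(n+1-\pi_1)$, and $\Pi^{rc}=\{\pi^{rc}:\pi\in\Pi\}$; equivalences between $\Pi$ and $\Pi^{rc}$ (or of $\Pi$ with itself) are called trivial. *)

(* Defs.v *)
From mathcomp Require Import all_boot all_order all_fingroup all_algebra.
Set Implicit Arguments.
Unset Strict Implicit.
Unset Printing Implicit Defensive.
Import GRing.Theory.

(* Positions and values are 0-based: for s : 'S_n, the letter written pi_(i+1)
   in one-line notation on {1, ..., n} is (s i).+1. *)

Section OneLine.
Variables (n : nat) (w : seq nat).
Hypothesis w_perm : perm_eq w (iota 1 n).

Definition one_line_fun (i : 'I_n) : 'I_n := insubd i (nth 0 w i).-1.

Fact one_line_funE i : (one_line_fun i).+1 = nth 0 w i.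
Proof.
have sz_w : size w = n by rewrite (perm_size w_perm) size_iota.
have : nth 0 w i \in iota 1 n by rewrite -(perm_mem w_perm) mem_nth ?sz_w.
rewrite mem_iota add1n ltnS => /andP[w_gt0 w_le].
have w_lt : (nth 0 w i).-1 < n by rewrite prednK.
by rewrite /one_line_fun val_insubd w_lt prednK.
Qed.

Fact one_line_fun_inj : injective one_line_fun.
Proof.
have sz_w : size w = n by rewrite (perm_size w_perm) size_iota.
have uniq_w : uniq w by rewrite (perm_uniq w_perm) iota_uniq.
move=> i j eq_ij; apply/val_inj/eqP => /=.
by rewrite -(nth_uniq 0 _ _ uniq_w) ?sz_w // -!one_line_funE eq_ij.
Qed.

Definition one_line : 'S_n := perm one_line_fun_inj.

Lemma one_lineE i : (one_line i).+1 = nth 0 w i.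
Proof. by rewrite permE one_line_funE. Qed.

End OneLine.

Definition p123 : 'S_3 := @one_line 3 [:: 1; 2; 3] isT.
Definition p132 : 'S_3 := @one_line 3 [:: 1; 3; 2] isT.
Definition p213 : 'S_3 := @one_line 3 [:: 2; 1; 3] isT.
Definition p231 : 'S_3 := @one_line 3 [:: 2; 3; 1] isT.
Definition p312 : 'S_3 := @one_line 3 [:: 3; 1; 2] isT.
Definition p321 : 'S_3 := @one_line 3 [:: 3; 2; 1] isT.

Definition contains (k n : nat) (sigma : 'S_k) (pi : 'S_n) : bool :=
  [exists f : {ffun 'I_k -> 'I_n},
    [forall i : 'I_k, forall j : 'I_k, (i < j) ==> (f i < f j)] &&
    [forall i : 'I_k, forall j : 'I_k,
       (sigma i < sigma j) == (pi (f i) < pi (f j))]].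

Definition avoiders (k n : nat) (Pi : {set 'S_k}) : {set 'S_n} :=
  [set pi : 'S_n | [forall sigma in Pi, ~~ contains sigma pi]].

Definition big_descent (n : nat) (pi : 'S_n) (k : 'I_n) : bool :=
  [exists l : 'I_n, (l == k.+1 :> nat) && ((pi l).+1 < pi k)].

Definition bdes (n : nat) (pi : 'S_n) : nat := #|[set k : 'I_n | big_descent pi k]|.

Definition bdes_poly (k n : nat) (Pi : {set 'S_k}) : {poly int} :=
  (\sum_(pi in avoiders n Pi) 'X^(bdes pi))%R.

Definition bdes_Wilf (k : nat) (Pi Pi' : {set 'S_k}) : Prop :=
  forall n : nat, bdes_poly n Pi = bdes_poly n Pi'.

Definition pattern_pairs : {set {set 'S_3}} := [set Pi : {set 'S_3} | #|Pi| == 2].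

Definition is_bdes_Wilf_class (C : {set {set 'S_3}}) : Prop :=
  exists2 Pi : {set 'S_3}, Pi \in pattern_pairs &
    forall Pi' : {set 'S_3}, Pi' \in C <-> Pi' \in pattern_pairs /\ bdes_Wilf Pi Pi'.

Fact revcomp_fun_inj (n : nat) (pi : 'S_n) :
  injective (fun i : 'I_n => rev_ord (pi (rev_ord i))).
Proof. by move=> i j /rev_ord_inj/perm_inj/rev_ord_inj. Qed.

Definition revcomp (n : nat) (pi : 'S_n) : 'S_n := perm (@revcomp_fun_inj n pi).

Definition revcomp_set (n : nat) (Pi : {set 'S_n}) : {set 'S_n} :=
  [set revcomp pi | pi in Pi].

Definition nontrivial_bdes_Wilf (k : nat) (Pi Pi' : {set 'S_k}) : Prop :=
  [/\ bdes_Wilf Pi Pi', Pi' <> Pi & Pi' <> revcomp_set Pi].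

Definition class1 : {set {set 'S_3}} :=
  [set [set p213; p231]; [set p132; p312]; [set p213; p312]; [set p132; p231]].
Definition class2 : {set {set 'S_3}} :=
  [set [set p231; p321]; [set p312; p321]].
Definition class3 : {set {set 'S_3}} :=
  [set [set p123; p231]; [set p123; p312]].
Definition class4 : {set {set 'S_3}} :=
  [set [set p132; p321]; [set p213; p321]].
Definition class5 : {set {set 'S_3}} :=
  [set [set p123; p132]; [set p123; p213]; [set p132; p213]].
Definition class6 : {set {set 'S_3}} := [set [set p123; p321]].
Definition class7 : {set {set 'S_3}} := [set [set p231; p312]].

Definition bdes_classes : seq {set {set 'S_3}} :=
  [:: class1; class2; class3; class4; class5; class6; class7].

(* Main.v *)
Require Import Defs.
From mathcomp Require Import all_boot all_order all_fingroup all_algebra.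
From mathcomp Require Import zify.

(* The seven classes are separated by the values at t = 5 of their polynomials for n = 4,
   namely 24, 20, 19, 27, 52, 36, 8. Inside a class, reverse-complement preserves bdes and
   handles everything but two equivalences, each obtained by coding both sets of avoiders
   by the same objects:
   - {213, 231} and {132, 231}: bit strings of length n - 1. In the first set every letter is
     the maximum or the minimum of the letters not before it; in the second one the largest
     letter is first or last, recursively. Both ways, bdes grows only when a maximum is put
     in front of a word that does not itself start with its maximum.
   - {132, 213} and {123, 132}: compositions of n. The words are concatenations of blocks on
     decreasing intervals of values, each block ending with its maximum and having its
     other letters increasing in the first set, decreasing in the second. Only the
     junctions between blocks can be big descents, and such a junction fails to be one
     exactly when both blocks have size 1. *)

Set Implicit Arguments.
Unset Strict Implicit.
Unset Printing Implicit Defensive.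
Import GRing.Theory.

(** * Permutations as words *)

Section Avoid.
Variable r : nat -> nat -> nat -> bool.

(** [r x y z] forbids the letters [x], [y], [z] met in this order. Recursion keeps the test
    computable, and an abstract [r] serves every pair of patterns. *)
Fixpoint avoid (w : seq nat) : bool :=
  if w is x :: w' then pairwise (fun y z => ~~ r x y z) w' && avoid w' else true.

(** The conjuncts sort the triples by how many of their letters lie in [u]: three, none, one,
    two. *)
Lemma avoid_cat u v :
  avoid (u ++ v) = [&& avoid u, avoid v,
    all (fun x => pairwise (fun y z => ~~ r x y z) v) u &
    pairwise (fun x y => all (fun z => ~~ r x y z) v) u].
Proof.
elim: u => [|x u IHu] /=; first by rewrite andbT.
rewrite pairwise_cat IHu /allrel -!andbA.
by do !bool_congr.
Qed.

Lemma avoid_cat_cons u M v : avoid (u ++ M :: v) ->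
  [/\ pairwise (fun x y => ~~ r x y M) u, allrel (fun x z => ~~ r x M z) u v,
      avoid u & avoid v].
Proof.
rewrite avoid_cat /= => /and4P[-> /andP[_ ->] av_mid av_last]; split=> //.
  by apply: sub_pairwise av_last => x y /= /andP[].
by apply: sub_all av_mid => x /= /andP[].
Qed.

Lemma avoidP w :
  reflect (forall i j k, i < j < k -> k < size w ->
             ~~ r (nth 0 w i) (nth 0 w j) (nth 0 w k))
          (avoid w).
Proof.
elim: w => [|x w IHw] /=; first by apply: ReflectT.
apply: (iffP andP) => [[/(pairwiseP 0) r_x /IHw r_w]|r_w].
  move=> [|i] [|j] [|k] //= lt_ijk lt_k; [|by rewrite andbF in lt_ijk|exact: r_w].
  by apply: r_x; rewrite ?inE //; lia.
split.
  by apply/(pairwiseP 0) => j k; rewrite !inE => ? ? ?; apply: (r_w 0 j.+1 k.+1).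
by apply/IHw => i j k ? ?; apply: (r_w i.+1 j.+1 k.+1).
Qed.

Lemma avoid_pairwise (R : rel nat) w :
    (forall x y z, R x y -> R y z -> R x z -> ~~ r x y z) ->
  pairwise R w -> avoid w.
Proof.
move=> rR; elim: w => //= x w IHw /andP[/allP Rx Rw].
rewrite IHw // andbT; apply: (sub_in_pairwise (P := mem w) (r := R)) => //.
by move=> y z wy wz Ryz; apply: rR; rewrite ?Rx.
Qed.

End Avoid.

(** Only comparisons matter, so a pattern on 1, 2, 3 can be matched against letters that start at 0.
    Comparing all ordered pairs of positions also rules out ties when the letters of [s] are
    distinct. *)
Definition matches (s v : seq nat) : bool :=
  all (fun i => all (fun j =>
    (nth 0 s i < nth 0 s j) == (nth 0 v i < nth 0 v j)) (iota 0 3)) (iota 0 3).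

Definition has_either (a b : seq nat) (x y z : nat) : bool :=
  matches a [:: x; y; z] || matches b [:: x; y; z].

Lemma avoid_either a b w :
  avoid (has_either a b) w =
  avoid (fun x y z => matches a [:: x; y; z]) w &&
  avoid (fun x y z => matches b [:: x; y; z]) w.
Proof.
elim: w => //= x w ->.
have -> : pairwise (fun y z => ~~ has_either a b x y z) w =
    pairwise (fun y z => ~~ matches a [:: x; y; z]) w &&
    pairwise (fun y z => ~~ matches b [:: x; y; z]) w.
  by rewrite -pairwise_relI; apply: eq_pairwise => y z; rewrite /= -negb_or.
by rewrite -!andbA; do !bool_congr.
Qed.

Definition word n (pi : 'S_n) : seq nat := [seq val (pi i) | i <- enum 'I_n].

Lemma size_word n (pi : 'S_n) : size (word pi) = n.
Proof. by rewrite size_map size_enum_ord. Qed.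

Lemma nth_word n (pi : 'S_n) (i : 'I_n) : nth 0 (word pi) i = pi i.
Proof. by rewrite (nth_map i) ?size_enum_ord // nth_ord_enum. Qed.

Lemma word_inj n : injective (@word n).
Proof.
move=> pi pi' eq_w; apply/permP => i; apply: val_inj.
by rewrite /= -!nth_word eq_w.
Qed.

Lemma word_perm_iota n (pi : 'S_n) : perm_eq (word pi) (iota 0 n).
Proof.
rewrite -val_enum_ord /word map_comp; apply: perm_map.
apply: uniq_perm; rewrite ?enum_uniq //.
  by rewrite map_inj_uniq ?enum_uniq //; apply: perm_inj.
move=> j; rewrite mem_enum; apply/mapP; exists (pi^-1 j)%g; first by rewrite mem_enum.
by rewrite permKV.
Qed.

(** One inclusion suffices: both lists are duplicate-free and have n! elements. *)
Lemma words_perm_eq n :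
  perm_eq [seq word pi | pi <- enum 'S_n] (permutations (iota 0 n)).
Proof.
have uniq_words : uniq [seq word pi | pi : 'S_n].
  by rewrite map_inj_uniq ?enum_uniq //; apply: word_inj.
apply: uniq_perm => //; first exact: permutations_uniq.
apply: (uniq_min_size uniq_words _ _).2.
  by move=> w /mapP[pi _ ->]; rewrite mem_permutations word_perm_iota.
by rewrite size_map -cardE card_Sn size_permutations ?iota_uniq // size_iota.
Qed.

Lemma contains_one_line s (sP : perm_eq s (iota 1 3)) n (pi : 'S_n) :
  contains (one_line sP) pi
    = ~~ avoid (fun x y z => matches s [:: x; y; z]) (word pi).
Proof.
apply/existsP/idP => [[f /andP[/forallP f_incr /forallP f_match]]|].
  have lt01 : (f ord0 < f (inord 1)).
    by move/forallP/(_ (inord 1)): (f_incr ord0); rewrite inordK.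
  have lt12 : (f (inord 1) < f (inord 2)).
    by move/forallP/(_ (inord 2)): (f_incr (inord 1)); rewrite !inordK.
  apply/negP => /avoidP/(_ (f ord0) (f (inord 1)) (f (inord 2))).
  rewrite lt01 lt12 size_word => /(_ isT (ltn_ord _))/negP; apply.
  have nthf i : i < 3 -> nth 0 [:: nth 0 (word pi) (f ord0);
      nth 0 (word pi) (f (inord 1)); nth 0 (word pi) (f (inord 2))] i
      = pi (f (inord i)).
    case: i => [|[|[|//]]] _ /=; rewrite nth_word //.
    by congr (val (pi (f _))); apply: val_inj; rewrite /= inordK.
  apply/allP => i; rewrite mem_iota => /andP[_ lt_i].
  apply/allP => j; rewrite mem_iota => /andP[_ lt_j].
  rewrite !nthf //; move/forallP/(_ (inord j)): (f_match (inord i)).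
  by rewrite -[val (one_line _ _) < _]ltnS !one_lineE !inordK.
move=> has_s; apply/existsP; apply: contraR has_s => /existsPn no_f.
apply/avoidP => i j k /andP[lt_ij lt_jk].
rewrite size_word => lt_k; apply/negP => /allP match_ijk.
have lt_j := ltn_trans lt_jk lt_k; have lt_i := ltn_trans lt_ij lt_j.
pose s3 := [:: Ordinal lt_i; Ordinal lt_j; Ordinal lt_k].
have /negP := no_f [ffun l : 'I_3 => nth (Ordinal lt_k) s3 l]; apply.
apply/andP; split; apply/forallP => a; apply/forallP => b; rewrite !ffunE.
  by case: a b => [[|[|[|//]]] ?] [[|[|[|//]]] ?] //=; rewrite ?lt_ij ?(ltn_trans lt_ij).
have nths l : l < 3 -> val (pi (nth (Ordinal lt_k) s3 l)) =
    nth 0 [:: nth 0 (word pi) i; nth 0 (word pi) j; nth 0 (word pi) k] l.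
  by case: l => [|[|[|//]]] _ /=; rewrite -nth_word.
rewrite !nths // -[val (one_line _ _) < _]ltnS !one_lineE.
have mem3 (c : 'I_3) : val c \in iota 0 3 by rewrite mem_iota ltn_ord.
exact: (allP (match_ijk _ (mem3 a)) _ (mem3 b)).
Qed.

(** The default [x] of [head] compares the last letter with itself, which never counts. *)
Fixpoint bdes_word (w : seq nat) : nat :=
  if w is x :: w' then ((head x w').+1 < x) + bdes_word w' else 0.

Lemma bdes_wordE w :
  bdes_word w = \sum_(i < size w) ((i.+1 < size w) && ((nth 0 w i.+1).+1 < nth 0 w i)).
Proof.
elim: w => [|x w IHw] /=; first by rewrite big_ord0.
rewrite big_ord_recl IHw /=; congr addn.
by case: w {IHw} => //=; rewrite ltnNge leqnSn.
Qed.

Lemma bdes_word_cons x w : w != [::] ->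
  bdes_word (x :: w) = ((head 0 w).+1 < x) + bdes_word w.
Proof. by case: w. Qed.

(** [rcons] exposes the letter before the junction; for empty [v] the default [x] makes the junction
    term vanish. *)
Lemma bdes_word_cat_rcons u x v :
  bdes_word (rcons u x ++ v) =
  bdes_word (rcons u x) + ((head x v).+1 < x) + bdes_word v.
Proof.
elim: u => [|y u IHu]; first by rewrite /= (_ : x.+1 < x = false) //; lia.
by case: u IHu => [|z u]; rewrite /= => ->; rewrite !addnA.
Qed.

(** Both positions of a descent become summation indices, so that reverse-complement amounts to
    exchanging the sums and reversing both indices. *)
Lemma bdesE n (pi : 'S_n) :
  bdes pi = \sum_(k < n) \sum_(l < n) ((l == k.+1 :> nat) && ((pi l).+1 < pi k)).
Proof.
rewrite /bdes -sum1_card big_mkcond /=; apply: eq_bigr => k _; rewrite inE.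
have [/existsP[l /andP[/eqP l_k lt_pi]]|/existsPn no_l] := boolP (big_descent pi k).
  rewrite (bigD1 l) //= l_k eqxx lt_pi big1 ?addn0 // => l' ne_l'.
  by rewrite -l_k val_eqE (negPf ne_l').
by rewrite big1 // => l _; rewrite (negPf (no_l l)).
Qed.

Lemma bdes_word_word n (pi : 'S_n) : bdes_word (word pi) = bdes pi.
Proof.
rewrite bdes_wordE bdesE size_word; apply: eq_bigr => k _.
have [lt_k|le_n] := ltnP k.+1 n; last first.
  rewrite big1 // => l _; case: eqP => //= l_k.
  by have := ltn_ord l; rewrite l_k ltnNge le_n.
rewrite (bigD1 (Ordinal lt_k)) //= eqxx /= big1 ?addn0 => [|l ne_l].
  by rewrite (nth_word pi k) -(nth_word pi (Ordinal lt_k)).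
by case: eqP => // l_k; case/eqP: ne_l; apply: val_inj.
Qed.

(** * Invariance under reverse-complement *)

Lemma bdes_revcomp n (pi : 'S_n) : bdes (revcomp pi) = bdes pi.
Proof.
rewrite !bdesE exchange_big /= (reindex_inj rev_ord_inj) /=.
apply: eq_bigr => k _; rewrite (reindex_inj rev_ord_inj) /=.
apply: eq_bigr => l _; rewrite !permE /= !rev_ordK.
have := ltn_ord k; have := ltn_ord l.
have := ltn_ord (pi k); have := ltn_ord (pi l).
lia.
Qed.

Lemma revcompK n : involutive (@revcomp n).
Proof. by move=> pi; apply/permP => i; rewrite !permE !rev_ordK. Qed.

Lemma contains_revcomp k n (s : 'S_k) (pi : 'S_n) :
  contains s pi -> contains (revcomp s) (revcomp pi).
Proof.
case/existsP=> f /andP[/'forall_forallP f_incr /'forall_forallP f_match].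
apply/existsP; exists [ffun i => rev_ord (f (rev_ord i))].
have rev_lt m (i j : 'I_m) : (rev_ord i < rev_ord j) = (j < i).
  by have := ltn_ord i; have := ltn_ord j; rewrite /=; lia.
apply/andP; split; apply/'forall_forallP => i j.
  rewrite !ffunE rev_lt; apply/implyP => lt_ij.
  by apply: (implyP (f_incr _ _)); rewrite rev_lt.
by rewrite !ffunE !permE !rev_ordK !rev_lt f_match.
Qed.

Lemma bdes_Wilf_revcomp k (Pi : {set 'S_k}) : bdes_Wilf Pi (revcomp_set Pi).
Proof.
move=> n; rewrite /bdes_poly [RHS](reindex_inj (can_inj (@revcompK n))) /=.
apply: eq_big => [pi|pi _]; last by rewrite bdes_revcomp.
rewrite !inE; apply/forall_inP/forall_inP => [avPi _ /imsetP[s Pi_s ->]|avPi s Pi_s].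
  by apply: contra (avPi s Pi_s) => /contains_revcomp; rewrite !revcompK.
by apply: contra (avPi (revcomp s) (imset_f _ Pi_s)); apply: contains_revcomp.
Qed.

(** * Avoiders of two patterns as lists of words *)

Definition avoid_words (a b : seq nat) (n : nat) : seq (seq nat) :=
  [seq w <- permutations (iota 0 n) | avoid (has_either a b) w].

Lemma mem_avoid_words a b n w :
  (w \in avoid_words a b n) = perm_eq w (iota 0 n) && avoid (has_either a b) w.
Proof. by rewrite mem_filter mem_permutations andbC. Qed.

Lemma avoid_words_uniq a b n : uniq (avoid_words a b n).
Proof. by rewrite filter_uniq ?permutations_uniq. Qed.

Lemma bdes_poly_words a b (aP : perm_eq a (iota 1 3)) (bP : perm_eq b (iota 1 3)) n :
  bdes_poly n [set one_line aP; one_line bP]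
    = (\sum_(w <- avoid_words a b n) 'X^(bdes_word w))%R.
Proof.
rewrite /bdes_poly big_filter -(perm_big _ (words_perm_eq n)) big_map /=.
rewrite big_enum_cond /=; apply: eq_big => [pi|pi _]; last by rewrite bdes_word_word.
rewrite !inE avoid_either; apply/forall_inP/andP => [avPi|[av_a av_b] s].
  split; [have := avPi (one_line aP)|have := avPi (one_line bP)];
    by rewrite !inE eqxx ?orbT contains_one_line negbK; apply.
by rewrite !inE => /orP[] /eqP->; rewrite contains_one_line negbK.
Qed.

Lemma has_213_231 x y z :
  has_either [:: 2; 1; 3] [:: 2; 3; 1] x y z = (y < x < z) || (z < x < y).
Proof. by rewrite /has_either /matches /=; lia. Qed.

(** Both patterns have their largest letter in the middle; [x != z] discards ties. *)
Lemma has_132_231 x y z :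
  has_either [:: 1; 3; 2] [:: 2; 3; 1] x y z = [&& x < y, z < y & x != z].
Proof. by rewrite /has_either /matches /=; lia. Qed.

Lemma has_132_213 x y z :
  has_either [:: 1; 3; 2] [:: 2; 1; 3] x y z = (x < z < y) || (y < x < z).
Proof. by rewrite /has_either /matches /=; lia. Qed.

Lemma has_123_132 x y z :
  has_either [:: 1; 2; 3] [:: 1; 3; 2] x y z = [&& x < y, x < z & y != z].
Proof. by rewrite /has_either /matches /=; lia. Qed.

(** * Words on an interval of values *)

Lemma perm_eq1 (x y : nat) : perm_eq [:: x] [:: y] -> x = y.
Proof. by move/perm_mem/(_ x); rewrite !inE eqxx => /esym/eqP. Qed.

Lemma pairwise_mem (R : rel nat) w :
  (forall x y, x \in w -> y \in w -> R x y) -> pairwise R w.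
Proof.
by move=> Rw; apply/(pairwiseP 0) => i j lt_i lt_j _; apply: Rw; apply: mem_nth.
Qed.

Lemma pairwise_rev (R : rel nat) w :
  pairwise R (rev w) = pairwise (fun x y => R y x) w.
Proof. by elim: w => //= x w IHw; rewrite rev_cons pairwise_rcons all_rev IHw. Qed.

Lemma iota_rcons m n : iota m n.+1 = rcons (iota m n) (m + n).
Proof. by rewrite -cats1 -addn1 iotaD. Qed.

Lemma perm_cons_max w m n : perm_eq (m + n :: w) (iota m n.+1) = perm_eq w (iota m n).
Proof. by rewrite iota_rcons perm_sym perm_rcons perm_cons perm_sym. Qed.

(** Sorting [u] and [v] separately yields a sorted rearrangement of the interval, hence [iota m n]
    itself, which is then cut at [size u]. *)
Lemma perm_iota_cat u v m n :
    perm_eq (u ++ v) (iota m n) -> allrel ltn u v ->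
  perm_eq u (iota m (size u)) /\ perm_eq v (iota (m + size u) (size v)).
Proof.
move=> uv_iota lt_uv.
have eq_n : n = size u + size v by rewrite -size_cat (perm_size uv_iota) size_iota.
have : sort leq u ++ sort leq v = iota m n.
  apply: (@pairwise_eq _ leq).
  - by move=> x y; rewrite -eqn_leq => /eqP.
  - rewrite pairwise_cat -!sorted_pairwise ?sort_sorted ?andbT;
      try by [apply: leq_total|move=> ? ? ?; apply: leq_trans].
    apply/allrelP => x y; rewrite !mem_sort => ux vy.
    exact: (ltnW (allrelP lt_uv _ _ ux vy)).
  - by rewrite -sorted_pairwise ?iota_sorted // => ? ? ?; apply: leq_trans.
  - by rewrite -(permPr uv_iota); apply: perm_cat; rewrite perm_sort.
rewrite eq_n iotaD => /eqP; rewrite eqseq_cat ?size_sort ?size_iota //.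
by case/andP=> /eqP <- /eqP <-; rewrite !(perm_sym _ (sort _ _)) !perm_sort.
Qed.

(* The codes need not be enumerated, since a list of them can be read off [L1]. *)
Lemma eq_sum_codes (V : nmodType) (T : eqType) (valid : pred T)
    (e1 e2 : T -> seq nat) (L1 L2 : seq (seq nat)) (F : seq nat -> V) :
  uniq L1 -> uniq L2 -> {in valid &, injective e1} -> {in valid &, injective e2} ->
  (forall w, w \in L1 <-> exists2 c, valid c & w = e1 c) ->
  (forall w, w \in L2 <-> exists2 c, valid c & w = e2 c) ->
  (forall c, valid c -> F (e1 c) = F (e2 c)) ->
  (\sum_(w <- L1) F w = \sum_(w <- L2) F w)%R.
Proof.
move=> uniq1 uniq2 inj1 inj2 L1P L2P eqF.
have [cs L1_cs cs_valid] : exists2 cs, L1 = map e1 cs & all valid cs.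
  have : forall w, w \in L1 -> exists2 c, valid c & w = e1 c by move=> w /L1P.
  elim: (L1) => [|w L IHL] code_L; first by exists [::].
  have [c c_valid ->] := code_L w (mem_head _ _).
  have [|cs -> cs_valid] := IHL; first by move=> v Lv; apply: code_L; rewrite inE Lv orbT.
  by exists (c :: cs); rewrite //= c_valid.
have uniq_cs : uniq cs by apply: (@map_uniq _ _ e1); rewrite -L1_cs.
have mem_cs c : (c \in cs) = valid c.
  apply/idP/idP => [/(allP cs_valid)//|c_valid].
  have : e1 c \in L1 by apply/L1P; exists c.
  by rewrite L1_cs => /mapP[c' cs_c' /inj1->] //; apply: (allP cs_valid).
have L2_cs : perm_eq L2 (map e2 cs).
  apply: uniq_perm => //.
    by rewrite map_inj_in_uniq // => c c'; rewrite !mem_cs; apply: inj2.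
  move=> w; apply/idP/mapP => [/L2P[c c_valid ->]|[c cs_c ->]].
    by exists c; rewrite ?mem_cs.
  by apply/L2P; exists c; rewrite -?mem_cs.
rewrite (perm_big _ L2_cs) L1_cs !big_map; apply: eq_big_seq => c.
by rewrite mem_cs => /eqF.
Qed.

(** * The equivalence of {213, 231} and {132, 231} *)

(** The letters still to be placed run from [m] to [m + size b]: there is one more letter than bits,
    the last one being forced. *)
Fixpoint extremal_first m (b : seq bool) : seq nat :=
  if b is x :: b' then
    if x then m + size b :: extremal_first m b' else m :: extremal_first m.+1 b'
  else [:: m].

(** Built outwards from 0 by adding ever larger letters at either end, so the word decreases to 0
    and then increases. *)
Fixpoint valley (b : seq bool) : seq nat :=
  if b is x :: b' then
    if x then size b :: valley b' else rcons (valley b') (size b)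
  else [:: 0].

Lemma perm_extremal_first m b : perm_eq (extremal_first m b) (iota m (size b).+1).
Proof.
elim: b m => [|[] b IHb] m //; last by rewrite /= perm_cons.
by rewrite perm_cons_max.
Qed.

Lemma perm_valley b : perm_eq (valley b) (iota 0 (size b).+1).
Proof.
elim: b => [|[] b IHb] //; first by rewrite (perm_cons_max _ 0).
by rewrite /= -/(iota 0 (size b).+2) perm_rcons (perm_cons_max _ 0).
Qed.

Lemma size_extremal_first m b : size (extremal_first m b) = (size b).+1.
Proof. by rewrite (perm_size (perm_extremal_first m b)) size_iota. Qed.

Lemma size_valley b : size (valley b) = (size b).+1.
Proof. by rewrite (perm_size (perm_valley b)) size_iota. Qed.

Lemma mem_extremal_first m b x : (x \in extremal_first m b) = (m <= x <= m + size b).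
Proof. by rewrite (perm_mem (perm_extremal_first m b)) mem_iota addnS. Qed.

Lemma mem_valley b x : (x \in valley b) = (x <= size b).
Proof. by rewrite (perm_mem (perm_valley b)) mem_iota. Qed.

Lemma head_extremal_first m b : m <= head 0 (extremal_first m b) <= m + size b.
Proof. by rewrite -mem_extremal_first -nth0 mem_nth ?size_extremal_first. Qed.

Lemma head_valley b : head 0 (valley b) <= size b.
Proof. by rewrite -mem_valley -nth0 mem_nth ?size_valley. Qed.

(** The first letter reveals the first bit, since [m] and [m + size b] differ as long as [b] is
    nonempty. *)
Lemma extremal_first_inj n m : {in [pred b | size b == n] &, injective (extremal_first m)}.
Proof.
move=> b b' /eqP sz_b /eqP sz_b'.
elim: b b' n m sz_b sz_b' => [|x b IHb] [|x' b'] //= n m; try by move=> <-.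
move=> <- [eq_sz]; rewrite eq_sz; case: x x' => [] [] eq_w.
- by case: eq_w => /(IHb _ _ _ (erefl _) eq_sz) ->.
- by case: eq_w; lia.
- by case: eq_w; lia.
- by case: eq_w => /(IHb _ _ _ (erefl _) eq_sz) ->.
Qed.

Lemma valley_inj n : {in [pred b | size b == n] &, injective valley}.
Proof.
move=> b b' /eqP sz_b /eqP sz_b'.
elim: b b' n sz_b sz_b' => [|x b IHb] [|x' b'] //= n; try by move=> <-.
move=> <- [eq_sz]; rewrite eq_sz.
have head_rcons c y : head 0 (rcons (valley c) y) = head 0 (valley c).
  by have := size_valley c; case: (valley c).
case: x x' => [] [].
- by case=> /(IHb _ _ (erefl _) eq_sz) ->.
- move/(congr1 (head 0)); rewrite head_rcons /= => eq_h.
  by have := head_valley b'; lia.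
- move/(congr1 (head 0)); rewrite head_rcons /= => eq_h.
  by have := head_valley b; lia.
- by case/rcons_inj => /(IHb _ _ (erefl _) eq_sz) ->.
Qed.

(** The second conjunct carries the induction: a new maximum in front makes a big descent exactly
    when the rest does not start with its own maximum. *)
Lemma bdes_extremal_first_valley m b :
  bdes_word (extremal_first m b) = bdes_word (valley b) /\
  (head 0 (extremal_first m b) == m + size b) = (head 0 (valley b) == size b).
Proof.
elim: b m => [|x b IHb] m /=; first by split; lia.
have nil_e k : extremal_first k b != [::] by rewrite -size_eq0 size_extremal_first.
have nil_v : valley b != [::] by rewrite -size_eq0 size_valley.
case: x; rewrite !bdes_word_cons //.
  have [-> eq_max] := IHb m; rewrite !eqxx; split=> //.
  by have := head_extremal_first m b; have := head_valley b; lia.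
have [-> _] := IHb m.+1.
have := head_extremal_first m.+1 b; have := head_valley b.
have -> : head 0 (rcons (valley b) (size b).+1) = head 0 (valley b).
  by case: (valley b) nil_v.
split; last by rewrite /=; lia.
(* The new maximum comes last, so the step to it from the former last letter [y] is an ascent. *)
rewrite -cats1; case/lastP: (valley b) nil_v (mem_valley b) => // v y _ mem_v.
rewrite bdes_word_cat_rcons /=.
have : y <= size b by rewrite -mem_v mem_rcons mem_head.
lia.
Qed.

(** A smaller and a larger letter after [x] would form 213 or 231 with it, so every later letter is
    on the same side of [x] as the first of them. *)
Lemma one_sided x w : x \notin w ->
  pairwise (fun y z => ~~ ((y < x < z) || (z < x < y))) w ->
  all (ltn x) w || all (gtn x) w.
Proof.
case: w => //= y w; rewrite inE negb_or => /andP[ne_xy xw] /andP[/allP y_w _].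
have [lt_xy|lt_yx|eq_xy] := ltngtP x y; last by rewrite eq_xy eqxx in ne_xy.
  rewrite orbF; apply/allP => z wz; have := y_w z wz.
  have : x != z by apply: contraNneq xw => ->.
  by rewrite /=; lia.
apply/allP => z wz; have := y_w z wz.
have : x != z by apply: contraNneq xw => ->.
by rewrite /=; lia.
Qed.

Lemma extremal_firstP m n w :
  perm_eq w (iota m n.+1) && avoid (has_either [:: 2; 1; 3] [:: 2; 3; 1]) w <->
  exists2 b, size b == n & w = extremal_first m b.
Proof.
split=> [/andP[]|[b /eqP <- ->]]; last first.
  rewrite perm_extremal_first /=.
  elim: b m {n w} => [|[] b IHb] m //=; rewrite IHb andbT;
    by apply: pairwise_mem => y z; rewrite !mem_extremal_first has_213_231; lia.
elim: n m w => [|n IHn] m w w_iota.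
  by rewrite (perm_small_eq _ w_iota) //; exists [::].
case: w w_iota => [/perm_size//|x w] xw_iota /= /andP[].
have sz_w : size w = n.+1.
  by apply/eqP; rewrite -eqSS -(size_iota m n.+2) -(perm_size xw_iota).
have /andP[xw _] : uniq (x :: w) by rewrite (perm_uniq xw_iota) iota_uniq.
have -> : pairwise (fun y z => ~~ has_either [:: 2; 1; 3] [:: 2; 3; 1] x y z) w
    = pairwise (fun y z => ~~ ((y < x < z) || (z < x < y))) w.
  by apply: eq_pairwise => y z; rewrite has_213_231.
move=> /(one_sided xw)/orP[lt_xw|gt_xw] av_w.
  have [|] := @perm_iota_cat [:: x] w m n.+2 xw_iota.
    by rewrite allrel1l.
  move=> /perm_eq1 ->; rewrite addn1 sz_w => w_iota.
  have [b sz_b ->] := IHn _ _ w_iota av_w.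
  by exists (false :: b).
(* Here [x] is the maximum; it is moved to the end because [perm_iota_cat] expects the smaller
   values first. *)
have [||w_iota x_iota] := @perm_iota_cat w [:: x] m n.+2.
- by rewrite cats1 perm_rcons.
- by rewrite allrel1r.
rewrite sz_w in w_iota x_iota; have [b /eqP sz_b ->] := IHn _ _ w_iota av_w.
have -> := perm_eq1 x_iota.
by exists (true :: b); rewrite /= sz_b.
Qed.

(** Letters on both sides of the maximum would form 132 or 231 with it, so the maximum is first or
    last; removing it leaves a shorter avoider. *)
Lemma valleyP n w :
  perm_eq w (iota 0 n.+1) && avoid (has_either [:: 1; 3; 2] [:: 2; 3; 1]) w <->
  exists2 b, size b == n & w = valley b.
Proof.
split=> [/andP[]|[b /eqP <- ->]]; last first.
  rewrite perm_valley /=; elim: b {n w} => [|[] b IHb] //=.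
    rewrite IHb andbT; apply: pairwise_mem => y z.
    by rewrite !mem_valley has_132_231; lia.
  rewrite -cats1 avoid_cat IHb /= all_predT /=; apply: pairwise_mem => y z.
  by rewrite !mem_valley has_132_231; lia.
elim: n w => [|n IHn] w w_iota.
  by rewrite (perm_small_eq _ w_iota) //; exists [::].
have Mw : n.+1 \in w by rewrite (perm_mem w_iota) mem_iota add0n /=.
case/splitPr: w / Mw w_iota => u v uv_iota /avoid_cat_cons[_ av_uv av_u av_v].
have Mw_iota : perm_eq (n.+1 :: u ++ v) (iota 0 n.+2).
  by rewrite -[_ :: _]/([:: n.+1] ++ u ++ v) -perm_catCA.
have w_iota : perm_eq (u ++ v) (iota 0 n.+1) by rewrite -(perm_cons_max _ 0).
have uniq_w : uniq (u ++ v) by rewrite (perm_uniq w_iota) iota_uniq.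
have lt_uv x : x \in u ++ v -> x < n.+1 by rewrite (perm_mem w_iota) mem_iota.
case: u v {uv_iota Mw_iota} av_u av_v av_uv w_iota uniq_w lt_uv => [|x u] [|z v] //.
- move=> _ av_v _ w_iota _ _; have [b /eqP sz_b ->] := IHn (z :: v) w_iota av_v.
  by exists (true :: b); rewrite /= sz_b.
- move=> av_u _ _ w_iota _ _; rewrite cats0 in w_iota.
  have [b /eqP sz_b eq_u] := IHn _ w_iota av_u.
  by exists (false :: b); rewrite //= ?sz_b // -eq_u cats1.
(* Neither side of the maximum is empty: [x], the maximum and [z] form a forbidden triple. *)
move=> _ _ /allrelP/(_ x z) + _ /andP[x_uv _] lt_uv.
have ne_xz : x != z by apply: contraNneq x_uv => ->; rewrite mem_cat mem_head orbT.
rewrite !mem_head has_132_231 ne_xz !lt_uv ?mem_head ?mem_cat ?mem_head ?orbT //.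
by move/(_ isT isT).
Qed.

Lemma bdes_Wilf_213_231 : bdes_Wilf [set p213; p231] [set p132; p231].
Proof.
move=> n; rewrite (@bdes_poly_words [:: 2; 1; 3] [:: 2; 3; 1] isT isT).
rewrite (@bdes_poly_words [:: 1; 3; 2] [:: 2; 3; 1] isT isT).
(* A code of length [n] gives a word of length [n.+1], so the empty permutation is settled apart. *)
case: n => // n.
apply: (eq_sum_codes (avoid_words_uniq _ _ _) (avoid_words_uniq _ _ _)
          (@extremal_first_inj n 0) (@valley_inj n)).
- by move=> w; rewrite mem_avoid_words; apply: extremal_firstP.
- by move=> w; rewrite mem_avoid_words; apply: valleyP.
by move=> b _; have [->] := bdes_extremal_first_valley 0 b.
Qed.

(** * The equivalence of {132, 213} and {123, 132} *)

(* The entry [j] of [c] stands for a part [j.+1] of the composition, which makes all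
   lists of natural numbers valid. *)
Definition total (c : seq nat) := sumn (map succn c).

Lemma total_cons j c : total (j :: c) = total c + j.+1.
Proof. by rewrite addnC. Qed.

(** The later blocks use the values below [total c'], the first one the [j.+1] values from there on;
    [f] arranges all of these but the maximum. *)
Fixpoint blocks (f : seq nat -> seq nat) (c : seq nat) : seq nat :=
  if c is j :: c' then rcons (f (iota (total c') j)) (total c' + j) ++ blocks f c'
  else [::].

Section Blocks.
Variable f : seq nat -> seq nat.
Hypothesis f_perm : forall s, perm_eq (f s) s.

Lemma perm_blocks c : perm_eq (blocks f c) (iota 0 (total c)).
Proof.
elim: c => // j c IHc.
rewrite total_cons iotaD perm_catC perm_cat //.
by rewrite perm_rcons perm_cons_max.
Qed.

Lemma mem_blocks c x : (x \in blocks f c) = (x < total c).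
Proof. by rewrite (perm_mem (perm_blocks c)) mem_iota. Qed.

(** The maximum of the word ends its first block, so its position gives the first entry of the
    code. *)
Lemma blocks_inj n : {in [pred c | total c == n] &, injective (blocks f)}.
Proof.
move=> c c' /eqP <- /eqP; elim: c c' => [|j c IHc] [|j' c'] //= eq_tot.
have size_f m k : size (f (iota m k)) = k by rewrite (perm_size (f_perm _)) size_iota.
have {eq_tot} : total c' + j' = total c + j by move: eq_tot; rewrite !total_cons; lia.
move=> eq_tot; rewrite eq_tot => eq_w.
have index_max m k M v : m + k = M -> index M (rcons (f (iota m k)) M ++ v) = k.
  move=> eq_M; rewrite cat_rcons index_cat (perm_mem (f_perm _)) mem_iota eq_M ltnn andbF.
  by rewrite size_f /= eqxx addn0.
have eq_j : j = j'.
  by rewrite -(index_max (total c) j _ (blocks f c) (erefl _)) eq_w index_max.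
rewrite -eq_j in eq_tot eq_w *; have {}eq_tot : total c' = total c by lia.
by congr cons; apply: IHc => //; move/eqP: eq_w; rewrite eq_tot eqseq_cat // eqxx => /eqP.
Qed.

Variable r : nat -> nat -> nat -> bool.
(** [r_above] and [r_below] make triples across several blocks harmless. [r_mid] forces the letters
    before a maximum to exceed those after it. [f_avoid] and [f_unique] make [f] the only admissible
    arrangement before a maximum. *)
Hypothesis r_above : forall x y z, z < x -> z < y -> ~~ r x y z.
Hypothesis r_below : forall x y z, y < x -> z < x -> ~~ r x y z.
Hypothesis r_mid : forall x y z, x < y -> z < y -> x != z -> ~~ r x y z -> z < x.
Hypothesis f_avoid : forall m j, avoid r (rcons (f (iota m j)) (m + j)).
Hypothesis f_unique : forall u m j M, perm_eq u (iota m j) ->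
  m + j <= M -> pairwise (fun x y => ~~ r x y M) u -> u = f (iota m j).

(** An avoider is cut just after its maximum: the prefix takes the top values and is a block, and
    the suffix is a shorter avoider. *)
Lemma blocksP n w :
  perm_eq w (iota 0 n) && avoid r w <-> exists2 c, total c == n & w = blocks f c.
Proof.
split=> [/andP[]|[c /eqP <- ->]]; last first.
  rewrite perm_blocks //=; elim: c {n w} => //= j c IHc.
  have block_ge x : x \in rcons (f (iota (total c) j)) (total c + j) -> total c <= x.
    by rewrite mem_rcons inE (perm_mem (f_perm _)) mem_iota; lia.
  rewrite avoid_cat f_avoid IHc /=; apply/andP; split.
    apply/allP => x /block_ge le_x; apply: pairwise_mem => y z.
    by rewrite !mem_blocks // => lt_y lt_z; apply: r_below; lia.
  apply: pairwise_mem => x y /block_ge le_x /block_ge le_y; apply/allP => z.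
  by rewrite mem_blocks // => lt_z; apply: r_above; lia.
elim/ltn_ind: n w => -[|n] IHn w w_iota av_w.
  by exists [::] => //; apply: perm_small_eq w_iota.
have lt_w x : (x \in w) = (x < n.+1) by rewrite (perm_mem w_iota) mem_iota.
have Mw : n \in w by rewrite lt_w.
case/splitPr: w / Mw w_iota lt_w av_w => u v uv_iota lt_uv
  /avoid_cat_cons[av_u av_uv _ av_v].
(* The two parts are swapped to put the smaller values first, as [perm_iota_cat] requires. *)
have vuM_iota : perm_eq (v ++ rcons u n) (iota 0 n.+1).
  by rewrite perm_catC cat_rcons.
have uniq_w : uniq (v ++ rcons u n) by rewrite (perm_uniq vuM_iota) iota_uniq.
have sz_uv : size v + size u = n.
  by have := perm_size vuM_iota; rewrite size_cat size_rcons size_iota; lia.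
have lt_v x : x \in v -> x < n.
  move=> vx; have := lt_uv x; rewrite mem_cat inE vx !orbT ltnS leq_eqVlt => /esym.
  case/orP=> // /eqP eq_x; move: uniq_w; rewrite cat_uniq => /and3P[_ /hasPn/(_ x)].
  by rewrite eq_x mem_rcons mem_head -eq_x vx => /(_ isT).
have lt_u x : x \in u -> x < n.
  move=> ux; have := lt_uv x; rewrite mem_cat ux ltnS leq_eqVlt => /esym.
  case/orP=> // /eqP eq_x; move: uniq_w; rewrite cat_uniq rcons_uniq => /and4P[_ _ + _].
  by rewrite -eq_x ux.
have [|v_iota u_iota] := perm_iota_cat vuM_iota.
  apply/allrelP => z x vz; rewrite mem_rcons inE => /orP[/eqP->|ux]; first exact: lt_v.
  apply: r_mid (lt_u _ ux) (lt_v _ vz) _ (allrelP av_uv _ _ ux vz).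
  apply: contraTneq uniq_w => eq_xz; rewrite cat_uniq negb_and negb_and negbK.
  apply/orP; right; apply/orP; left; apply/hasP.
  by exists x; rewrite ?eq_xz // mem_rcons inE -eq_xz ux orbT.
rewrite add0n size_rcons in u_iota.
have {}u_iota : perm_eq u (iota (size v) (size u)).
  by rewrite -perm_cons_max sz_uv -perm_rcons.
have [|c /eqP sz_c eq_v] := IHn (size v) _ v v_iota av_v; first by lia.
exists (size u :: c); first by rewrite total_cons sz_c addnS sz_uv.
rewrite /= sz_c sz_uv -eq_v cat_rcons; congr (_ ++ _).
by apply: f_unique u_iota _ av_u; lia.
Qed.

End Blocks.

(** Descents inside a block drop by 1 only. For consecutive entries [j], [k] of the code, the
    junction is a big descent in both words unless [j = k = 0]. *)
Lemma bdes_blocks c : bdes_word (blocks id c) = bdes_word (blocks rev c).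
Proof.
have bdes_inc m j : bdes_word (rcons (iota m j) (m + j)) = 0.
  rewrite -iota_rcons; elim: j m => [|j IHj] m; first by rewrite /=; lia.
  have -> : iota m j.+2 = m :: iota m.+1 j.+1 by [].
  by rewrite bdes_word_cons // IHj /=; lia.
have bdes_dec m j M : m <= M -> bdes_word (rcons (rev (iota m j)) M) = 0.
  move=> le_mM; elim: j => [|j IHj]; first by rewrite /=; lia.
  rewrite iota_rcons rev_rcons rcons_cons bdes_word_cons; last first.
    by case: (rev _).
  rewrite IHj addn0; case: j {IHj} => [|j]; last rewrite iota_rcons rev_rcons.
    by rewrite /=; lia.
  by rewrite /=; lia.
have head_id d x : head x (blocks id d) = if d is k :: d' then total d' else x.
  by case: d => // -[|k] d' //=; rewrite addn0.
(* For [k = 0] the block consists of its maximum [total d'] alone, which the truncated [k.-1] covers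
   as well. *)
have head_rev d x : head x (blocks rev d) =
    if d is k :: d' then total d' + k.-1 else x.
  case: d => // -[|k] d'; rewrite -?iota_rcons /= ?addn0 //.
  by rewrite -/(iota _ k.+1) iota_rcons rev_rcons.
elim: c => //= j c IHc.
rewrite !bdes_word_cat_rcons bdes_inc bdes_dec ?leq_addr // IHc head_id head_rev.
case: c {IHc} => [|k c]; rewrite ?total_cons; lia.
Qed.

Lemma bdes_Wilf_132_213 : bdes_Wilf [set p132; p213] [set p123; p132].
Proof.
move=> n; rewrite (@bdes_poly_words [:: 1; 3; 2] [:: 2; 1; 3] isT isT).
rewrite (@bdes_poly_words [:: 1; 2; 3] [:: 1; 3; 2] isT isT).
have perm_id (s : seq nat) : perm_eq (id s) s by [].
have perm_rev' (s : seq nat) : perm_eq (rev s) s by rewrite perm_rev.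
have ltn_iota m j : pairwise ltn (iota m j).
  by rewrite -sorted_pairwise ?iota_ltn_sorted //; apply: ltn_trans.
have sorted_inj (u v : seq nat) : pairwise leq u -> pairwise leq v -> perm_eq u v -> u = v.
  by apply: pairwise_eq => x y; rewrite -eqn_leq => /eqP.
apply: (eq_sum_codes (avoid_words_uniq _ _ _) (avoid_words_uniq _ _ _)
          (blocks_inj perm_id (n := n)) (blocks_inj perm_rev' (n := n))).
- move=> w; rewrite mem_avoid_words; apply: blocksP => //.
  + by move=> x y z; rewrite has_132_213; lia.
  + by move=> x y z; rewrite has_132_213; lia.
  + by move=> x y z; rewrite has_132_213; lia.
  + move=> m j; rewrite -iota_rcons.
    apply: avoid_pairwise (ltn_iota _ _) => x y z.
    by rewrite has_132_213 /=; lia.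
  (* A descent before the larger letter [M] would complete 213, so [u] is increasing. *)
  + move=> u m j M u_iota le_M av_u; apply: (sorted_inj _ _ _ _ u_iota); last first.
      by apply: sub_pairwise (ltn_iota m j) => x y /ltnW.
    apply: (sub_in_pairwise (P := mem u)) av_u; last exact/allP.
    by move=> x y /=; rewrite !(perm_mem u_iota) !mem_iota has_132_213; lia.
- move=> w; rewrite mem_avoid_words; apply: blocksP => //.
  + by move=> x y z; rewrite has_123_132; lia.
  + by move=> x y z; rewrite has_123_132; lia.
  + by move=> x y z; rewrite has_123_132; lia.
  + move=> m j; rewrite -cats1 avoid_cat /= all_predT /=.
    have dec : pairwise (fun x y => y < x) (rev (iota m j)).
      by rewrite pairwise_rev.
    apply/andP; split; last by apply: sub_pairwise dec => x y /=; rewrite has_123_132; lia.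
    by apply: avoid_pairwise dec => x y z; rewrite has_123_132; lia.
  (* An ascending pair before [M] would complete 123, so [u] is decreasing and its reversal is
     sorted. *)
  + move=> u m j M u_iota le_M av_u; rewrite -[u]revK; congr rev.
    apply: sorted_inj; last by rewrite perm_rev.
      rewrite pairwise_rev; apply: (sub_in_pairwise (P := mem u)) av_u; last exact/allP.
      by move=> x y /=; rewrite !(perm_mem u_iota) !mem_iota has_123_132; lia.
    by apply: sub_pairwise (ltn_iota m j) => x y /ltnW.
by move=> c _; rewrite bdes_blocks.
Qed.

(** * The seven classes *)

Lemma bdes_Wilf_sym k (Pi Pi' : {set 'S_k}) : bdes_Wilf Pi Pi' -> bdes_Wilf Pi' Pi.
Proof. by move=> eqPi n. Qed.

Lemma bdes_Wilf_trans k (Pi Pi' Pi'' : {set 'S_k}) :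
  bdes_Wilf Pi Pi' -> bdes_Wilf Pi' Pi'' -> bdes_Wilf Pi Pi''.
Proof. by move=> eqPi eqPi' n; rewrite eqPi. Qed.

Lemma word_one_line n s (sP : perm_eq s (iota 1 n)) :
  word (one_line sP) = map predn s.
Proof.
have sz_s : size s = n by rewrite (perm_size sP) size_iota.
apply: (@eq_from_nth _ 0); rewrite ?size_word ?size_map // => i lt_i.
by rewrite (nth_word _ (Ordinal lt_i)) (nth_map 0) ?sz_s // -(one_lineE sP (Ordinal lt_i)).
Qed.

(** The complement of [x] is [n + 1 - x], that is [n - x] once values start at 0. *)
Lemma word_revcomp_one_line n s (sP : perm_eq s (iota 1 n)) :
  word (revcomp (one_line sP)) = rev [seq n - x | x <- s].
Proof.
have sz_s : size s = n by rewrite (perm_size sP) size_iota.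
apply: (@eq_from_nth _ 0); rewrite ?size_word ?size_rev ?size_map // => i lt_i.
rewrite (nth_word _ (Ordinal lt_i)) nth_rev ?size_map ?sz_s // (nth_map 0) ?sz_s; last lia.
by rewrite !permE /= -(one_lineE sP (rev_ord (Ordinal lt_i))) permE.
Qed.

Lemma eq_one_line n s t (sP : perm_eq s (iota 1 n)) (tP : perm_eq t (iota 1 n)) :
  (one_line sP == one_line tP) = (map predn s == map predn t).
Proof. by rewrite -(inj_eq (@word_inj n)) !word_one_line. Qed.

Lemma S3_patterns (s : 'S_3) : s \in [:: p123; p132; p213; p231; p312; p321].
Proof.
rewrite -(mem_map (@word_inj 3)) /= !word_one_line.
have : word s \in permutations (iota 0 3) by rewrite mem_permutations word_perm_iota.
by rewrite !inE => /or4P[|||/or3P[]] ->; rewrite ?orbT.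
Qed.

Lemma revcomp_patterns :
  [/\ revcomp p123 = p123, revcomp p132 = p213, revcomp p231 = p312 & revcomp p321 = p321].
Proof. by split; apply: word_inj; rewrite word_revcomp_one_line word_one_line. Qed.

Lemma revcomp_set2 n (s t : 'S_n) : revcomp_set [set s; t] = [set revcomp s; revcomp t].
Proof. by rewrite /revcomp_set imsetU1 imset_set1. Qed.

(** In the first and fifth classes the representative is the left side of the non-trivial
    equivalence proved above. *)
Definition class_rep (k : nat) : {set 'S_3} :=
  nth set0 [:: [set p213; p231]; [set p231; p321]; [set p123; p231]; [set p132; p321];
               [set p132; p213]; [set p123; p321]; [set p231; p312]] k.

Lemma class_rep_in k : k < 7 -> class_rep k \in nth set0 bdes_classes k.
Proof. by case: k => [|[|[|[|[|[|[|//]]]]]]] _; rewrite /= !inE eqxx ?orbT. Qed.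

Lemma bdes_Wilf_class_rep k Pi :
  k < 7 -> Pi \in nth set0 bdes_classes k -> bdes_Wilf (class_rep k) Pi.
Proof.
have [rc123 rc132 rc231 rc321] := revcomp_patterns.
have rc213 : revcomp p213 = p132 by rewrite -rc132 revcompK.
have rcW (s t : 'S_3) : bdes_Wilf [set s; t] [set revcomp s; revcomp t].
  by rewrite -revcomp_set2; apply: bdes_Wilf_revcomp.
case: k => [|[|[|[|[|[|[|//]]]]]]] _; rewrite /= !inE.
- case/orP=> [/orP[/orP[]|]|] /eqP-> //.
  + by have := rcW p213 p231; rewrite rc213 rc231.
  + apply: bdes_Wilf_trans bdes_Wilf_213_231 _.
    by have := rcW p132 p231; rewrite rc132 rc231.
  + exact: bdes_Wilf_213_231.
- by case/orP=> /eqP-> //; have := rcW p231 p321; rewrite rc231 rc321.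
- by case/orP=> /eqP-> //; have := rcW p123 p231; rewrite rc123 rc231.
- by case/orP=> /eqP-> //; have := rcW p132 p321; rewrite rc132 rc321.
- case/orP=> [/orP[]|] /eqP-> //; first exact: bdes_Wilf_132_213.
  apply: bdes_Wilf_trans bdes_Wilf_132_213 _.
  by have := rcW p123 p132; rewrite rc123 rc132.
- by move/eqP->.
- by move/eqP->.
Qed.

(** Evaluating at 5 turns each polynomial into a sum of powers over a computable list of words; the
    seven values are distinct, which separates the classes. *)
Lemma bdes_poly_class_rep k : k < 7 ->
  ((bdes_poly 4 (class_rep k)).[5] = (nth 0 [:: 24; 20; 19; 27; 52; 36; 8] k)%N%:R :> int)%R.
Proof.
have poly5 a b (aP : perm_eq a (iota 1 3)) (bP : perm_eq b (iota 1 3)) :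
    ((bdes_poly 4 [set one_line aP; one_line bP]).[5]
      = (sumn [seq (5 ^ bdes_word w)%N | w <- avoid_words a b 4])%:R :> int)%R.
  rewrite bdes_poly_words horner_sum sumnE big_map natr_sum.
  by apply: eq_bigr => w _; rewrite hornerXn natrX.
by case: k => [|[|[|[|[|[|[|//]]]]]]] _; rewrite [LHS]poly5; congr (_%:R)%R; vm_compute.
Qed.

Lemma bdes_class_inj k l Pi Pi' : k < 7 -> l < 7 ->
  Pi \in nth set0 bdes_classes k -> Pi' \in nth set0 bdes_classes l ->
  bdes_Wilf Pi Pi' -> k = l.
Proof.
move=> lt_k lt_l /(bdes_Wilf_class_rep lt_k) repk /(bdes_Wilf_class_rep lt_l) repl eqPi.
have := bdes_poly_class_rep lt_k; rewrite repk eqPi -repl bdes_poly_class_rep //.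
by move/eqP; rewrite Num.Theory.eqr_nat nth_uniq // => /eqP.
Qed.

Lemma pattern_pairs_classes Pi :
  Pi \in pattern_pairs <-> exists2 k, k < 7 & Pi \in nth set0 bdes_classes k.
Proof.
rewrite inE; split=> [/cards2P[s [t [ne_st ->]]]|[k lt_k]].
  (* The case analysis runs over ordered pairs, while each class lists a pair in one order only. *)
  have solve_pair k u v : k < 7 -> ([set u; v] \in nth set0 bdes_classes k) ||
      ([set v; u] \in nth set0 bdes_classes k) ->
      exists2 k, k < 7 & [set u; v] \in nth set0 bdes_classes k.
    by move=> lt_k uv_k; exists k; rewrite // -[_ \in _]orbb {2}setUC.
  have := S3_patterns s; have := S3_patterns t; rewrite !inE.
  do 5?[case/orP]; move/eqP=> eq_t; do 5?[case/orP]; move/eqP=> eq_s;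
    rewrite {}eq_s {}eq_t in ne_st *; first [by rewrite eqxx in ne_st
    | by apply: (solve_pair 0) => //; rewrite /= !inE ?eqxx ?orbT
    | by apply: (solve_pair 1) => //; rewrite /= !inE ?eqxx ?orbT
    | by apply: (solve_pair 2) => //; rewrite /= !inE ?eqxx ?orbT
    | by apply: (solve_pair 3) => //; rewrite /= !inE ?eqxx ?orbT
    | by apply: (solve_pair 4) => //; rewrite /= !inE ?eqxx ?orbT
    | by apply: (solve_pair 5) => //; rewrite /= !inE ?eqxx ?orbT
    | by apply: (solve_pair 6) => //; rewrite /= !inE ?eqxx ?orbT].
case: k lt_k => [|[|[|[|[|[|[|//]]]]]]] _; rewrite /= !inE => Pi_k;
  by repeat case/orP: Pi_k => Pi_k; rewrite (eqP Pi_k) cards2 eq_one_line.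
Qed.

Lemma mem_bdes_class k Pi Pi' : k < 7 -> Pi \in nth set0 bdes_classes k ->
  Pi' \in nth set0 bdes_classes k <-> Pi' \in pattern_pairs /\ bdes_Wilf Pi Pi'.
Proof.
move=> lt_k Pi_k; split=> [Pi'_k|[/pattern_pairs_classes[l lt_l Pi'_l] eqPi]].
  split; first by apply/pattern_pairs_classes; exists k.
  exact: bdes_Wilf_trans (bdes_Wilf_sym (bdes_Wilf_class_rep lt_k Pi_k))
    (bdes_Wilf_class_rep lt_k Pi'_k).
by rewrite (bdes_class_inj lt_k lt_l Pi_k Pi'_l eqPi).
Qed.

Lemma bdes_classP k : k < 7 -> is_bdes_Wilf_class (nth set0 bdes_classes k).
Proof.
move=> lt_k; exists (class_rep k).
  by apply/pattern_pairs_classes; exists k => //; apply: class_rep_in.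
by move=> Pi; apply: mem_bdes_class lt_k (class_rep_in lt_k).
Qed.

Theorem theorem1p2 :
  [/\ #|pattern_pairs| = 15,
      uniq bdes_classes,
      forall C : {set {set 'S_3}}, is_bdes_Wilf_class C <-> C \in bdes_classes,
      exists Pi Pi' : {set 'S_3},
        [/\ Pi \in class1, Pi' \in class1 & nontrivial_bdes_Wilf Pi Pi']
    & exists Pi Pi' : {set 'S_3},
        [/\ Pi \in class5, Pi' \in class5 & nontrivial_bdes_Wilf Pi Pi']].
Proof.
have [rc123 rc132 rc231 rc321] := revcomp_patterns.
split.
- by rewrite /pattern_pairs card_draws card_Sn.
- apply/(uniqP set0) => k l; rewrite !inE => lt_k lt_l eq_kl.
  have rep_l : class_rep k \in nth set0 bdes_classes l by rewrite -eq_kl class_rep_in.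
  exact: (bdes_class_inj lt_k lt_l (class_rep_in lt_k) rep_l).
- move=> C; split=> [[Pi /pattern_pairs_classes[k lt_k Pi_k] CP]|].
    rewrite (_ : C = nth set0 bdes_classes k) ?mem_nth //.
    apply/setP => Pi'; apply/idP/idP.
      by move/CP/(mem_bdes_class Pi' lt_k Pi_k).
    by move/(mem_bdes_class Pi' lt_k Pi_k)/CP.
  by move/(nthP set0)=> [k lt_k <-]; apply: bdes_classP.
- exists [set p132; p231], [set p213; p231]; split; rewrite ?inE ?eqxx ?orbT //.
  split; first exact: bdes_Wilf_sym bdes_Wilf_213_231.
    by move/setP/(_ p213); rewrite !inE !eq_one_line.
  (* The reverse-complement of {132, 231} is {213, 312}, which lacks 231. *)
  rewrite revcomp_set2 rc132 rc231 => /setP/(_ p231).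
  by rewrite !inE !eq_one_line.
exists [set p132; p213], [set p123; p132]; split; rewrite ?inE ?eqxx ?orbT //.
split; first exact: bdes_Wilf_132_213.
  by move/setP/(_ p123); rewrite !inE !eq_one_line.
(* {132, 213} is its own reverse-complement and lacks 123. *)
rewrite revcomp_set2 -rc132 revcompK rc132 => /setP/(_ p123).
by rewrite !inE !eq_one_line.
Qed.
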